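(* Let $A\in\mathbb{C}^{n\times n}$. Then for generic $u,v\in\mathbb{C}^n$ and for all $\tau\in\mathbb{C}$ the algebraic multiplicity of the eigenvalues of $A+\tau uv^\top$ that are not eigenvalues of $A$ is at most two.
   Context: A subset $\Omega\subseteq\mathbb{C}^N$ is called generic if $\Omega$ is nonempty and its complement $\mathbb{C}^N\setminus\Omega$ is contained in a (complex) algebraic set which is not $\mathbb{C}^N$. The phrase ''Let $A\in\mathbb{C}^{n\times n}$. Then for generic $u,v\in\mathbb{C}^n$ ...'' means: for every $A\in\mathbb{C}^{n\times n}$ there exists a generic subset $\Omega$ of $\mathbb{C}^{2n}$, possibly dependent on $A$, such that for all $(u,v)\in\Omega$ the stated property holds. In particular $\Omega$ does not depend on $\tau$. *)

(* Defs.v *)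
From mathcomp Require Import all_boot all_order all_algebra.
From mathcomp Require Import classical_sets.
From mathcomp Require Import mpoly.

Set Implicit Arguments.
Unset Strict Implicit.
Unset Printing Implicit Defensive.

Import GRing.Theory.
Local Open Scope ring_scope.
Local Open Scope classical_set_scope.

Definition zero_locus (K : fieldType) (N : nat) (ps : seq {mpoly K[N]}) :
    set 'cV[K]_N :=
  [set x | forall p : {mpoly K[N]}, p \in ps -> p.@[fun i => x i ord0] = 0].

Definition algebraic_set (K : fieldType) (N : nat) (X : set 'cV[K]_N) : Prop :=
  exists ps : seq {mpoly K[N]}, X = zero_locus ps.

Definition generic (K : fieldType) (N : nat) (Omega : set 'cV[K]_N) : Prop :=
  Omega !=set0 /\
  exists X : set 'cV[K]_N, [/\ algebraic_set X, X <> setT & ~` Omega `<=` X].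

(* Main.v *)
Require Import Defs.
From mathcomp Require Import all_boot all_order all_algebra.
From mathcomp Require Import mpoly.
From mathcomp Require Import classical_sets reals complex.
From mathcomp Require Import ring.

(** Write p for the characteristic polynomial of A, M = z - A, and
    q = v^T (adj M) u, so that A + tau u v^T has characteristic polynomial
    p - tau q by the rank-one determinant formula.  A triple root lambda of
    p - tau q with p(lambda) <> 0 forces tau <> 0, and lambda is then a critical
    point of order two of q / p: eliminating tau, it is a multiple root of the
    Wronskian p' q - p q' ([triple_root_wronskian]), which no longer involves
    tau.  Differentiating M (adj M) = p shows that this Wronskian is the bilinear
    form v^T (adj M)^2 u ([adj_char_poly_mx_sqr]).

    Let g be the gcd of the entries of (adj M)^2, so that (adj M)^2 = g N where
    the entries of N have no common root.  Since (adj M)^2 M^2 = p^2, the roots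
    of g are eigenvalues of A.  It remains to see that for generic (u, v) the
    polynomial v^T N u has no multiple root at all.

    This is a Bertini theorem on the affine line.  In a pencil a + x b, a multiple
    root for the member x is a root of the Wronskian of a and b, which does not
    depend on x, so that for all but finitely many x the multiple roots of a + x b
    are multiple roots of both a and b ([pencil_roots]).  Adding one vector at a
    time gives a single pair (u, v) for which v^T N u has only simple roots.  The
    resultant of v^T N u and its derivative, computed with u and v as
    indeterminates, is then a polynomial in (u, v) that does not vanish at this
    pair, and v^T N u has only simple roots wherever it does not vanish
    ([generic_no_multiple_root]). *)

Set Implicit Arguments.
Unset Strict Implicit.
Unset Printing Implicit Defensive.

Import GRing.Theory Num.Theory.
Local Open Scope ring_scope.
Local Open Scope classical_set_scope.

(** * Multiple roots *)

Definition multiple_root (K : fieldType) (f : {poly K}) (x : K) : bool :=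
  root f x && root f^`() x.

Lemma multiple_root_mull (K : fieldType) (g f : {poly K}) (x : K) :
  ~~ root g x -> multiple_root (g * f) x -> multiple_root f x.
Proof.
move=> gx /andP[]; rewrite /multiple_root rootM (negPf gx) /= => fx.
rewrite fx derivM !rootE !hornerE (eqP (fx : f.[x] == 0)) mulr0 add0r.
by rewrite mulf_eq0 (negPf (gx : g.[x] != 0)).
Qed.

Lemma multiple_root_polyC (K : fieldType) (c x : K) :
  multiple_root c%:P x = (c == 0).
Proof. by rewrite /multiple_root derivC rootC root0 andbT. Qed.

Lemma multiple_root_sqr_factor (K : fieldType) (f : {poly K}) (x : K) :
  multiple_root (('X - x%:P) ^+ 2 * f) x.
Proof.
rewrite /multiple_root expr2 -mulrA rootM root_XsubC eqxx /=.
by rewrite derivM derivXsubC mul1r rootE !hornerE subrr !mul0r addr0.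
Qed.

Lemma multiple_root_scale (K : fieldType) (c : K) (f : {poly K}) (x : K) :
  c != 0 -> multiple_root (c *: f) x = multiple_root f x.
Proof. by move=> c0; rewrite /multiple_root derivZ !rootZ. Qed.

(** * Bertini for linear systems of polynomials *)

Section Bertini.
Variable K : numClosedFieldType.
Implicit Types (a b f g : {poly K}) (x lambda : K).

Lemma exists_nonroot f : f != 0 -> exists x, ~~ root f x.
Proof.
move=> f0; pose s : seq K := [seq k%:R | k <- iota 0 (size f)].
have us : uniq s.
  by rewrite map_inj_uniq ?iota_uniq //; exact: (mulrIn (oner_neq0 K)).
have [as_|/allPn[x _ fx]] := boolP (all (root f) s); last by exists x.
by have := max_poly_roots f0 as_ us; rewrite size_map size_iota ltnn.
Qed.

Lemma deriv_eq0_size f : f^`() = 0 -> (size f <= 1)%N.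
Proof.
move=> f'0; apply/leq_sizeP => -[//|j] _.
have /eqP := congr1 (fun p : {poly K} => p`_j) f'0.
by rewrite coef_deriv coef0 mulrn_eq0 /= => /eqP.
Qed.

Lemma size_le2_multiple_root f x :
  (size f <= 2)%N -> multiple_root f x -> f = 0.
Proof.
move=> f_small /andP[fx f'x].
have f'0 : f^`() = 0.
  have f'c : (size f^`() <= 1)%N.
    have [->|f0] := eqVneq f 0; first by rewrite deriv0 size_poly0.
    by rewrite -ltnS (leq_trans (lt_size_deriv f0)).
  move: f'x; rewrite (size1_polyC f'c) rootC => /eqP->; exact: polyC0.
move: fx; rewrite (size1_polyC (deriv_eq0_size f'0)) rootC => /eqP->.
exact: polyC0.
Qed.

(** After division by the gcd, b divides a b', hence b'; for degree reasons
    b' = 0, so b is a constant in characteristic zero, and so is a. *)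
Lemma wronskian_eq0 a b :
  b != 0 -> a * b^`() = a^`() * b -> exists c, a = c *: b.
Proof.
move=> b0 W0; pose g := gcdp a b.
have g0 : g != 0 by rewrite gcdp_eq0 negb_and b0 orbT.
have [a1 aE] : exists a1, a = g * a1.
  by exists (a %/ g); rewrite mulrC divpK ?dvdp_gcdl.
have [b1 bE] : exists b1, b = g * b1.
  by exists (b %/ g); rewrite mulrC divpK ?dvdp_gcdr.
have b10 : b1 != 0 by apply: contraNneq b0 => e; rewrite bE e mulr0.
have co : coprimep b1 a1.
  rewrite coprimep_sym.
  have := @coprimep_div_gcd _ a b; rewrite b0 orbT => /(_ isT).
  by rewrite -/g {1}aE {1}bE ![g * _]mulrC !mulpK.
have W1 : a1 * b1^`() = a1^`() * b1.
  apply: (mulfI g0); apply: (mulfI g0); apply/eqP; rewrite -subr_eq0.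
  move/eqP: W0; rewrite -subr_eq0 aE bE !derivM => /eqP W0.
  by rewrite -[X in _ == X]W0; apply/eqP; ring.
have b1'0 : b1^`() = 0.
  apply: contraTeq (lt_size_deriv b10) => b1'0; rewrite -leqNgt.
  by apply: dvdp_leq => //; rewrite -(Gauss_dvdpr _ co) W1 dvdp_mull.
have a1'0 : a1^`() = 0.
  by apply: (mulIf b10); rewrite -W1 b1'0 mulr0 mul0r.
rewrite aE bE.
have eb := size1_polyC (deriv_eq0_size b1'0).
have ea := size1_polyC (deriv_eq0_size a1'0).
exists (a1`_0 / b1`_0).
rewrite scalerAr {2}eb -mul_polyC -polyCM divfK -?ea //.
by move: b10; rewrite {1}eb polyC_eq0.
Qed.

(** A common root of a + x b and a' + x b' is a root of the Wronskian of a and b,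
    so only finitely many candidates occur, whatever x.  At a candidate l where
    (a, b) or (a', b') does not vanish, at most one x gives a multiple root.  If
    the Wronskian is zero, then a and b are proportional and at most one member
    of the pencil is to be avoided. *)
Lemma pencil_roots a b :
  exists2 D : {poly K}, D != 0 & forall x, ~~ root D x -> forall lambda,
    multiple_root (a + x *: b) lambda ->
    multiple_root a lambda && multiple_root b lambda.
Proof.
have linN0 (s t : K) : ~~ ((s == 0) && (t == 0)) -> s%:P + t *: 'X != 0.
  apply: contraNneq => e; have := coefC s 0; rewrite eqxx => <-.
  have := congr1 (fun p : {poly K} => p`_0) e.
  have := congr1 (fun p : {poly K} => p`_1) e.
  by rewrite !coefE /= add0r mulr1 mulr0 addr0 => -> ->; rewrite eqxx.
have [-> | b0] := eqVneq b 0.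
  exists 1 => [|x _ lambda]; first exact: oner_neq0.
  by rewrite scaler0 addr0 => ->; rewrite /multiple_root deriv0 root0.
have [e | W0] := eqVneq (a * b^`()) (a^`() * b).
  have [c ->] := wronskian_eq0 b0 e.
  exists ('X + c%:P) => [|x]; first exact: monic_neq0 (monicXaddC c).
  rewrite rootE !hornerE => xc lambda.
  rewrite -scalerDl multiple_root_scale 1?addrC // => bl.
  rewrite bl andbT; move: bl; rewrite /multiple_root derivZ !rootE !hornerE.
  by case/andP=> /eqP-> /eqP->; rewrite mulr0 eqxx.
rewrite -subr_eq0 in W0; set W := _ - _ in W0.
have [r Wr] := closed_field_poly_normal W.
(* Unless f and g both vanish at l, a nonzero polynomial in x that is zero when
   f + x g vanishes at l; the value 1 imposes no condition on x. *)
pose d f g l : {poly K} :=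
  if root f l && root g l then 1 else f.[l]%:P + g.[l] *: 'X.
exists (\prod_(l <- r) (d a b l * d a^`() b^`() l)).
  rewrite prodf_seq_neq0; apply/allP => l _ /=.
  by rewrite mulf_neq0 // /d; case: ifPn => [_|/linN0//]; exact: oner_neq0.
move=> x Dx l /andP[/eqP]; rewrite derivD derivZ rootE !hornerE => e1 /eqP e2.
have lr : l \in r.
  have : root W l.
    rewrite rootE /W !hornerE.
    have -> : a.[l] = - (x * b.[l]) by apply/eqP; rewrite -addr_eq0 e1.
    have -> : a^`().[l] = - (x * b^`().[l]) by apply/eqP; rewrite -addr_eq0 e2.
    by apply/eqP; ring.
  by rewrite Wr rootZ ?lead_coef_eq0 // root_prod_XsubC.
rewrite rootE horner_prod prodf_seq_neq0 in Dx.
move/allP: Dx => /(_ _ lr) /=.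
rewrite hornerM mulf_eq0 negb_or => /andP[].
rewrite /multiple_root /d.
case: ifP => [/andP[-> ->] _|_]; last by rewrite !hornerE mulrC e1 eqxx.
by case: ifP => [/andP[-> ->] //|_]; rewrite !hornerE mulrC e2 eqxx.
Qed.

(** Several pencils are treated with one parameter because the choices of
    v and u below must suit several linear systems simultaneously. *)
Lemma pencils_good_member (J : finType) (a b : J -> {poly K}) :
  exists x, forall j lambda, multiple_root (a j + x *: b j) lambda ->
    multiple_root (a j) lambda && multiple_root (b j) lambda.
Proof.
have /fin_all_exists[D DP] : forall j, exists D : {poly K}, D != 0 /\
    forall x, ~~ root D x -> forall lambda,
    multiple_root (a j + x *: b j) lambda ->
    multiple_root (a j) lambda && multiple_root (b j) lambda.
  by move=> j; have [D D0 DP] := pencil_roots (a j) (b j); exists D.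
have /exists_nonroot[x] : \prod_j D j != 0.
  by apply/prodf_neq0 => j _; case: (DP j).
rewrite rootE horner_prod => /prodf_neq0 xP; exists x => j.
exact: (DP j).2 (xP j isT).
Qed.

(** Adjoining the polynomials one at a time, each step moves in the pencil
    spanned by the combination already chosen and the next polynomial. *)
Lemma linear_systems_good_member (J : finType) n (w : J -> 'I_n -> {poly K}) :
  exists c : 'I_n -> K, forall j lambda,
    multiple_root (\sum_i c i *: w j i) lambda ->
    forall i, multiple_root (w j i) lambda.
Proof.
elim: n w => [|n IHn] w; first by exists (fun _ => 0) => j lambda _ [].
have [c cP] := IHn (fun j i => w j (lift ord0 i)).
have [x xP] := pencils_good_member
  (fun j => \sum_i c i *: w j (lift ord0 i)) (fun j => w j ord0).
exists (fun i => oapp c x (unlift ord0 i)) => j lambda.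
rewrite big_ord_recl unlift_none /= addrC.
under eq_bigr do rewrite liftK /=.
move=> /xP/andP[/cP lP w0] i.
by case: (unliftP ord0 i) => [i'|] ->.
Qed.

End Bertini.

(** * Bilinear systems *)

Definition bilin (K : fieldType) n (v u : 'cV[K]_n) (N : 'M[{poly K}]_n) :=
  \sum_i \sum_k (v i ord0 * u k ord0) *: N i k.

(** First v is chosen so that the multiple roots of each entry of v^T N are
    multiple roots of a whole column of N, then u for the row v^T N. *)
Lemma bilinear_systems_good_member (K : numClosedFieldType) (J : finType) n
    (N : J -> 'M[{poly K}]_n) :
  exists u v : 'cV[K]_n, forall j lambda,
    multiple_root (bilin v u (N j)) lambda ->
    forall i k, multiple_root (N j i k) lambda.
Proof.
have [v vP] := linear_systems_good_member
  (fun (jk : J * 'I_n) i => N jk.1 i jk.2).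
have [u uP] := linear_systems_good_member
  (fun j k => \sum_i v i *: N j i k).
exists (\col_k u k), (\col_i v i) => j lambda.
have -> : bilin (\col_i v i) (\col_k u k) (N j) =
    \sum_k u k *: (\sum_i v i *: N j i k).
  rewrite /bilin exchange_big; apply: eq_bigr => k _.
  rewrite scaler_sumr; apply: eq_bigr => i _.
  by rewrite !mxE scalerA mulrC.
by move=> /uP lP i k; apply: (vP (j, k)); exact: lP.
Qed.

(** * From one good member to a generic one *)

Lemma resultant_map (aR rR : comNzRingType) (h : {rmorphism aR -> rR})
    (p q : {poly aR}) :
  h (lead_coef p) != 0 -> h (lead_coef q) != 0 ->
  h (resultant p q) = resultant (map_poly h p) (map_poly h q).
Proof.
move=> hp hq; rewrite /resultant /Sylvester_mx !size_map_poly_id0 //.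
rewrite -det_map_mx map_col_mx; congr (\det (col_mx _ _));
  by apply: map_lin1_mx => w; rewrite map_poly_rV rmorphM /= map_rVpoly.
Qed.

(** The resultant of f and f' is a combination of f and f', so it vanishes
    wherever the specialised f has a multiple root.  The leading coefficient has
    to survive at x0, since otherwise the resultant of the specialised polynomials
    is not the specialised resultant.  In degree at most one f' is constant
    and a multiple root makes f zero, so the leading coefficient is a witness. *)
Lemma generic_no_multiple_root (K : numClosedFieldType) m
    (f : {poly {mpoly K[m]}}) (x0 : 'I_m -> K) :
  (lead_coef f).@[x0] != 0 ->
  (forall lambda, ~~ multiple_root (map_poly (meval x0) f) lambda) ->
  exists2 D : {mpoly K[m]}, D.@[x0] != 0 &
    forall x, D.@[x] != 0 -> forall lambda,
      ~~ multiple_root (map_poly (meval x) f) lambda.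
Proof.
move=> lc0 simple0.
have f0 : f != 0 by apply: contraNneq lc0 => ->; rewrite lead_coef0 raddf0.
have map_lc x : (map_poly (meval x) f)`_(size f).-1 = (lead_coef f).@[x].
  by rewrite coef_map.
have [f_small | f_large] := leqP (size f) 2.
  exists (lead_coef f) => // x Dx lambda; apply: contraNN Dx => /size_le2_multiple_root e.
  by rewrite -map_lc e ?coef0 // (leq_trans (size_poly _ _)).
have d_gt0 : (0 < (size f).-1)%N by case: (size f) f_large => [|[]].
have lc'0 : (lead_coef f *+ (size f).-1).@[x0] != 0.
  by rewrite mevalMn mulrn_eq0 negb_or -lt0n d_gt0.
have size_f' : size f^`() = (size f).-1.
  apply/eqP; rewrite eqn_leq -ltnS prednK ?size_poly_gt0 // lt_size_deriv //=.
  rewrite -(prednK d_gt0) ltnNge; apply: contraNN lc'0.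
  move=> /leq_sizeP/(_ _ (leqnn _)).
  by rewrite coef_deriv lead_coefE prednK // => ->; rewrite raddf0.
have f'_lc : lead_coef f^`() = lead_coef f *+ (size f).-1.
  by rewrite lead_coefE size_f' coef_deriv prednK.
have f'_large : (1 < size f^`())%N.
  by rewrite size_f' -ltnS prednK ?size_poly_gt0.
have [[a b] /= _ D_ab] := resultant_in_ideal (ltnW f_large) f'_large.
exists (resultant f f^`()) => [|x Dx lambda].
  rewrite resultant_map -?deriv_map ?f'_lc // resultant_eq0 -leqNgt leqNgt.
  apply/negP => gcd_large.
  have /closed_rootP[l] : size (gcdp (map_poly (meval x0) f)
      (map_poly (meval x0) f)^`()) != 1%N by rewrite gtn_eqF.
  by rewrite root_gcd => ml; have /negP := simple0 l.
apply: contraNN Dx => /andP[/eqP fl /eqP f'l].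
have := congr1 (fun p : {poly {mpoly K[m]}} => (map_poly (meval x) p).[lambda]) D_ab.
rewrite map_polyC hornerC /= rmorphD !rmorphM /= hornerD !hornerM fl.
by rewrite -deriv_map f'l !mulr0 addr0 => ->.
Qed.

Lemma dvdp_biggcd (K : fieldType) (d : {poly K}) (ps : seq {poly K}) :
  (d %| \big[@gcdp K/0]_(p <- ps) p) = all (fun p => d %| p) ps.
Proof.
elim: ps => [|p ps IHps]; first by rewrite big_nil dvdp0.
by rewrite big_cons dvdp_gcd IHps.
Qed.

(** The gcd of the entries is factored out: a root common to all
    quotients would give a common divisor of larger degree. *)
Lemma factor_common_roots (K : fieldType) m n (M : 'M[{poly K}]_(m, n)) :
  M != 0 -> exists (g : {poly K}) (N : 'M[{poly K}]_(m, n)),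
    M = g *: N /\ forall x, exists i k, ~~ root (N i k) x.
Proof.
move=> M0; pose g := \big[@gcdp K/0]_(p <- [seq M ik.1 ik.2 | ik : 'I_m * 'I_n]) p.
have g_dvd i k : g %| M i k.
  have := dvdpp g; rewrite {2}/g dvdp_biggcd => /allP; apply.
  by apply/mapP; exists (i, k); rewrite ?mem_enum.
have MgN i k : g * (M i k %/ g) = M i k by rewrite mulrC divpK.
have g0 : g != 0.
  apply: contraNneq M0 => g0; apply/eqP/matrixP => i k.
  by rewrite -MgN g0 mul0r mxE.
exists g, (\matrix_(i, k) (M i k %/ g)); split=> [|x].
  by apply/matrixP => i k; rewrite !mxE MgN.
have [/forallP allx|] := boolP [forall i, [forall k, root (M i k %/ g) x]]; last first.
  rewrite negb_forall => /existsP[j]; rewrite negb_forall => /existsP[k].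
  by exists j, k; rewrite mxE.
have : ('X - x%:P) * g %| g.
  rewrite {2}/g dvdp_biggcd; apply/allP => _ /mapP[[i k] _ ->] /=.
  rewrite -MgN mulrC dvdp_mul2l // -root_factor_theorem.
  exact: (forallP (allx i) k).
by move=> /(dvdp_leq g0); rewrite size_monicM ?monicXsubC // size_XsubC /= ltnn.
Qed.

(** The leading coefficient of the generic bilinear form f must not vanish
    at the chosen pair.  This is one more instance of the Bertini property:
    applied to the constant polynomials formed by the top coefficients of the
    entries of N, it says that their combination is zero only if all are zero. *)
Lemma generic_bilin_no_multiple_root (K : numClosedFieldType) n
    (N : 'M[{poly K}]_n) :
  (forall x, exists i k, ~~ root (N i k) x) ->
  exists D : {mpoly K[n + n]}, (exists w, D.@[w] != 0) /\
    forall u v : 'cV[K]_n, D.@[fun i => col_mx u v i ord0] != 0 ->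
    forall lambda, ~~ multiple_root (bilin v u N) lambda.
Proof.
move=> N_free.
pose f : {poly {mpoly K[n + n]}} := \sum_i \sum_k
  ('X_(rshift n i) * 'X_(lshift n k)) *: map_poly (@mpolyC (n + n) K) (N i k).
pose pt (u v : 'cV[K]_n) := fun i => col_mx u v i ord0.
have pt_u u v k : pt u v (lshift n k) = u k ord0 by rewrite /pt col_mxEu.
have pt_v u v i : pt u v (rshift n i) = v i ord0 by rewrite /pt col_mxEd.
have coef_f x d : (f`_d).@[x] =
    \sum_i \sum_k x (rshift n i) * x (lshift n k) * (N i k)`_d.
  rewrite coef_sum rmorph_sum; apply: eq_bigr => i _.
  rewrite coef_sum rmorph_sum; apply: eq_bigr => k _.
  by rewrite coefZ coef_map /= !mevalM mevalC !mevalXU.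
have map_f u v : map_poly (meval (pt u v)) f = bilin v u N.
  apply/polyP => d; rewrite coef_map /= coef_f coef_sum; apply: eq_bigr => i _.
  by rewrite coef_sum; apply: eq_bigr => k _; rewrite coefZ pt_u pt_v.
have [u [v uvP]] := bilinear_systems_good_member (fun b : bool =>
  if b then N else map_mx (fun h : {poly K} => (h`_(size f).-1)%:P) N).
have simple0 l : ~~ multiple_root (bilin v u N) l.
  apply/negP => /(uvP true l) mr; have [i [k /negP]] := N_free l.
  by case; case/andP: (mr i k).
have lc0 : (lead_coef f).@[pt u v] != 0.
  apply/negP => /eqP lc0; have mr := uvP false 0.
  have {}mr i k : (N i k)`_(size f).-1 = 0.
    apply/eqP; rewrite -(multiple_root_polyC _ 0).
    have /(_ _ i k) := mr; rewrite mxE; apply.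
    suff -> : bilin v u (map_mx (fun h : {poly K} => (h`_(size f).-1)%:P) N) =
        ((lead_coef f).@[pt u v])%:P by rewrite lc0 multiple_root_polyC.
    rewrite lead_coefE coef_f rmorph_sum; apply: eq_bigr => j _.
    rewrite rmorph_sum; apply: eq_bigr => h _.
    by rewrite mxE pt_u pt_v [RHS]polyCM mul_polyC.
  have f0 : f = 0.
    apply/eqP; rewrite -lead_coef_eq0 lead_coefE coef_sum big1 // => i _.
    by rewrite coef_sum big1 // => k _; rewrite coefZ coef_map /= mr mpolyC0 mulr0.
  have := simple0 0; rewrite -map_f f0 rmorph0.
  by rewrite /multiple_root deriv0 root0.
have [|D D0 DP] := generic_no_multiple_root lc0.
  by move=> l; rewrite map_f.
exists D; split; first by exists (pt u v).
by move=> u' v' /DP D' l; rewrite -map_f.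
Qed.

(** * Rank-one perturbations *)

(** With B the block matrix of rows (M, u) and (v^T, 1), the determinant of B is
    that of the Schur complement M - u v^T; multiplying B on the right by a block
    triangular matrix of determinant det M computes it a second time, up to the
    nonzero factor det M. *)
Lemma det_sub_rank1 (R : idomainType) n (M : 'M[R]_n) (u v : 'cV[R]_n) :
  \det M != 0 ->
  \det (M - u *m v^T) = \det M - (v^T *m \adj M *m u) ord0 ord0.
Proof.
move=> M0; pose B := block_mx M u v^T 1%:M.
have detB : \det B = \det (M - u *m v^T).
  have : B *m block_mx 1%:M 0 (- v^T) 1%:M = block_mx (M - u *m v^T) u 0 1%:M.
    by rewrite mulmx_block !mulmx1 !mulmx0 mul1mx !add0r mulmxN subrr.
  move/(congr1 determinant).
  by rewrite det_mulmx det_lblock det_ublock !det1 !mulr1.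
apply: (mulIf M0); rewrite -detB.
have : B *m block_mx 1%:M (- (\adj M *m u)) 0 (\det M)%:M =
    block_mx M 0 v^T ((\det M)%:M - v^T *m \adj M *m u).
  rewrite mulmx_block !mulmx1 !mulmx0 !mulmxN !mulmxA mul_mx_adj mul1mx !addr0.
  by rewrite mul_scalar_mx mul_mx_scalar addNr [in RHS]addrC.
move/(congr1 determinant); rewrite det_mulmx det_ublock det_lblock det1 mul1r.
by rewrite det_scalar1 det_mx11 !mxE eqxx mulr1n => ->; rewrite mulrC.
Qed.

(** Differentiating M (adj M) = p, where M' = 1, gives adj M + M (adj M)' = p';
    multiplying by adj M on the left gives the formula. *)
Lemma adj_char_poly_mx_sqr (R : comNzRingType) n (A : 'M[R]_n) :
  let adjM := \adj (char_poly_mx A) in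
  adjM *m adjM =
  (char_poly A)^`() *: adjM - char_poly A *: map_mx (@deriv R) adjM.
Proof.
set M := char_poly_mx A => /=; set B := \adj M.
have derivM1 : map_mx (@deriv R) M = 1%:M.
  by apply/matrixP => i j; rewrite !mxE derivB derivC subr0 derivMn derivX.
have /(congr1 (map_mx (@deriv R))) := mul_mx_adj M.
have -> : map_mx (@deriv R) (M *m B) = B + M *m map_mx (@deriv R) B.
  rewrite -[X in X + _]mul1mx -derivM1; apply/matrixP => i j.
  rewrite !mxE -big_split /= raddf_sum; apply: eq_bigr => k _.
  by rewrite /= derivM !mxE.
have -> : map_mx (@deriv R) (\det M)%:M = ((char_poly A)^`())%:M :> 'M_n.
  by apply/matrixP => i j; rewrite !mxE derivMn.
move/(congr1 (mulmx B)); rewrite mulmxDr mulmxA mul_adj_mx mul_scalar_mx.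
by rewrite mul_mx_scalar => <-; rewrite addrK.
Qed.

Section Bilin.
Variables (K : fieldType) (n : nat) (v u : 'cV[K]_n).
Implicit Types N : 'M[{poly K}]_n.

Lemma bilinZ g N : bilin v u (g *: N) = g * bilin v u N.
Proof.
rewrite /bilin mulr_sumr; apply: eq_bigr => i _.
by rewrite mulr_sumr; apply: eq_bigr => k _; rewrite mxE scalerAr.
Qed.

Lemma bilinB N1 N2 : bilin v u (N1 - N2) = bilin v u N1 - bilin v u N2.
Proof.
rewrite /bilin -sumrB; apply: eq_bigr => i _.
by rewrite -sumrB; apply: eq_bigr => k _; rewrite !mxE scalerBr.
Qed.

Lemma deriv_bilin N : (bilin v u N)^`() = bilin v u (map_mx (@deriv K) N).
Proof.
rewrite /bilin raddf_sum; apply: eq_bigr => i _.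
by rewrite raddf_sum; apply: eq_bigr => k _; rewrite /= derivZ mxE.
Qed.

Lemma bilinE N :
  ((map_mx polyC v)^T *m N *m map_mx polyC u) ord0 ord0 = bilin v u N.
Proof.
rewrite mxE /bilin exchange_big; apply: eq_bigr => k _ /=.
rewrite mxE mulr_suml; apply: eq_bigr => i _.
by rewrite !mxE -mul_polyC polyCM; ring.
Qed.

End Bilin.

Lemma char_poly_rank1 (K : fieldType) n (A : 'M[K]_n) (u v : 'cV[K]_n) tau :
  char_poly (A + tau *: (u *m v^T)) =
  char_poly A - tau *: bilin v u (\adj (char_poly_mx A)).
Proof.
have -> : char_poly (A + tau *: (u *m v^T)) =
    \det (char_poly_mx A - map_mx polyC (tau *: u) *m (map_mx polyC v)^T).
  rewrite /char_poly; congr (\det _).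
  rewrite /char_poly_mx map_mxD opprD addrA scalemxAl map_mxM.
  by rewrite map_trmx.
rewrite det_sub_rank1 ?monic_neq0 ?char_poly_monic //.
rewrite map_mxZ -scalemxAr mxE bilinE; congr (_ - _); exact: mul_polyC.
Qed.

(** The Wronskian of p and tau q is that of p and -(p - tau q), and
    differentiation lowers the order of vanishing of p - tau q by one only. *)
Lemma triple_root_wronskian (K : fieldType) (p q : {poly K}) (tau x : K) :
  ~~ root p x -> ('X - x%:P) ^+ 3 %| p - tau *: q ->
  multiple_root (p^`() * q - p * q^`()) x.
Proof.
move=> px /dvdpP[h hE].
have tau0 : tau != 0.
  apply: contraNneq px => tau0; move: hE; rewrite tau0 scale0r subr0 => ->.
  by rewrite exprS mulrCA rootM root_XsubC eqxx.
rewrite -(multiple_root_scale _ _ tau0).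
have -> : tau *: (p^`() * q - p * q^`()) =
  ('X - x%:P) ^+ 2 * (p * (h^`() * ('X - x%:P) + h *+ 3) - p^`() * h * ('X - x%:P)).
  have tq : tau *: q = p - h * ('X - x%:P) ^+ 3 by rewrite -hE opprB addrC subrK.
  rewrite scalerBr !scalerAr -derivZ tq derivB derivM deriv_exp derivXsubC /=.
  by rewrite mul1r; ring.
exact: multiple_root_sqr_factor.
Qed.

(** * Generic multiplicities *)

Lemma generic_multiplicity_le2 (K : numClosedFieldType) n (A : 'M[K]_n) :
  exists D : {mpoly K[n + n]}, (exists w, D.@[w] != 0) /\
    forall u v : 'cV[K]_n, D.@[fun i => col_mx u v i ord0] != 0 ->
    forall tau lambda, ~~ eigenvalue A lambda ->
      (mup lambda (char_poly (A + tau *: (u *m v^T))) <= 2)%N.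
Proof.
case: n A => [|n] A.
  exists 1; split=> [|u v _ tau lambda _].
    by exists (fun=> 0); rewrite meval1 oner_neq0.
  rewrite mup_leq; last exact: monic_neq0 (char_poly_monic _).
  rewrite /char_poly det_mx00.
  by rewrite dvdp1 size_exp_XsubC.
set M := char_poly_mx A; set p := char_poly A.
have p0 : p != 0 by rewrite monic_neq0 ?char_poly_monic.
have adj2_p2 : \adj M *m \adj M *m (M *m M) = (p ^+ 2)%:M.
  rewrite mulmxA -[\adj M *m _ *m M]mulmxA mul_adj_mx -mulmxA mul_scalar_mx.
  by rewrite -scalemxAr mul_adj_mx scale_scalar_mx -expr2.
have adj2_0 : \adj M *m \adj M != 0.
  apply: contraNneq p0 => e; move: adj2_p2; rewrite e mul0mx.
  move/matrixP/(_ ord0 ord0)/esym/eqP; rewrite !mxE eqxx mulr1n.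
  by rewrite expf_eq0.
have [g [N [adj2E N_free]]] := factor_common_roots adj2_0.
have g_root x : root g x -> root p x.
  move=> gx; suff : root (p ^+ 2) x by rewrite /root horner_exp expf_eq0.
  have := congr1 (fun B : 'M_n.+1 => B ord0 ord0) adj2_p2.
  rewrite adj2E -scalemxAl !mxE eqxx mulr1n => <-.
  by rewrite rootM gx.
have [D [D0 DP]] := generic_bilin_no_multiple_root N_free.
exists D; split=> // u v /DP simple tau lambda.
rewrite eigenvalue_root_char -/p => pl.
rewrite mup_leq; last exact: monic_neq0 (char_poly_monic _).
rewrite char_poly_rank1 -/p.
apply/negP => /(triple_root_wronskian pl).
rewrite deriv_bilin -!bilinZ -bilinB -adj_char_poly_mx_sqr adj2E bilinZ.
move/multiple_root_mull => mr; apply: (negP (simple lambda)); apply: mr.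
by apply: contraNN pl; exact: g_root.
Qed.

Theorem theorem5p1 (R : realType) (n : nat) (A : 'M[R[i]]_n) :
  exists Omega : set 'cV[R[i]]_(n + n),
    generic Omega /\
    forall u v : 'cV[R[i]]_n, Omega (col_mx u v) ->
    forall tau lambda : R[i],
      eigenvalue (A + tau *: (u *m v^T)) lambda ->
      ~~ eigenvalue A lambda ->
      (mup lambda (char_poly (A + tau *: (u *m v^T))) <= 2)%N.
Proof.
have [D [[w Dw] DP]] := generic_multiplicity_le2 A.
pose x : 'cV[R[i]]_(n + n) := \col_i w i.
have Dx : ~ zero_locus [:: D] x.
  move=> /(_ D (mem_head _ _)) e; move: Dw; rewrite -e => /eqP; apply.
  by apply: meval_eq => i; rewrite mxE.
exists (~` zero_locus [:: D]); split.
  split; first by exists x.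
  exists (zero_locus [:: D]); split; first by exists [:: D].
    by move=> e; apply: Dx; rewrite e.
  by rewrite setCK.
move=> u v Duv tau lambda _; apply: DP.
apply/negP => /eqP e; apply: Duv => q; rewrite inE => /eqP->; exact: e.
Qed.
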